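(* Let $k$ be an arbitrary (complex) number, and let $(a_n)_{n\ge 0}$ be the sequence defined by \[ \sum_{n\ge 0} a_n x^n = \frac{1}{1-kx+kx^2-x^3} = \frac{1}{(1-x)(1-(k-1)x+x^2)}. \] Then $(a_n)$ is fixed by $\mathcal{L}$, that is, $a_n^2 - a_{n-1}a_{n+1} = a_n$ for all $n\ge 0$ (with $a_{-1}=0$). Moreover $a_0=1$ and $a_1=k$.
   Context: For a sequence $(a_n)_{n\ge 0}$, $\mathcal{L}$ denotes the operator sending $(a_n)$ to the sequence $(a_n^2 - a_{n-1}a_{n+1})_{n\ge 0}$, with the convention $a_{-1}=0$. A sequence is fixed by $\mathcal{L}$ if $\mathcal{L}(a_n)=(a_n)$. *)

(* Defs.v *)
From HB Require Import structures.
From mathcomp Require Import all_boot all_order all_algebra.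
From mathcomp Require Import reals complex.

Set Implicit Arguments.
Unset Strict Implicit.
Unset Printing Implicit Defensive.

Import Order.TTheory GRing.Theory Num.Theory.
Local Open Scope ring_scope.

Section FormalPowerSeries.
Variable R : comUnitRingType.

(* A formal power series is identified with its coefficient sequence: the
   sequence a stands for \sum_n a n x^n. *)
Definition fps := nat -> R.

Definition fps_of_poly (p : {poly R}) : fps := fun n => p`_n.

Definition fps_mul (f g : fps) : fps :=
  fun n => \sum_(i < n.+1) f (n - i)%N * g i.

(* The first n coefficients of 1/f, obtained by solving f * g = 1 for the
   coefficients of g one after the other. *)
Fixpoint fps_inv_coefs (f : fps) (n : nat) : seq R :=
  if n is m.+1 then
    let s := fps_inv_coefs f m in
    rcons s ((f 0%N)^-1 * ((m == 0%N)%:R - \sum_(i < m) f (m - i)%N * s`_i))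
  else [::].

(* Meaningful only when f 0 is a unit; see fps_invP. *)
Definition fps_inv (f : fps) : fps := fun n => (fps_inv_coefs f n.+1)`_n.

Lemma size_fps_inv_coefs f n : size (fps_inv_coefs f n) = n.
Proof. by elim: n => //= n IHn; rewrite size_rcons IHn. Qed.

Lemma nth_fps_inv_coefs f n i :
  (i < n)%N -> (fps_inv_coefs f n)`_i = fps_inv f i.
Proof.
elim: n => // n IHn; rewrite ltnS leq_eqVlt => /predU1P[-> // | lt_in].
by rewrite /= nth_rcons size_fps_inv_coefs lt_in IHn.
Qed.

Lemma fps_invE f n :
  fps_inv f n =
    (f 0%N)^-1 * ((n == 0%N)%:R - \sum_(i < n) f (n - i)%N * fps_inv f i).
Proof.
rewrite {1}/fps_inv /= nth_rcons size_fps_inv_coefs ltnn eqxx.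
by under eq_bigr => i _ do rewrite nth_fps_inv_coefs //.
Qed.

Lemma fps_invP (f g : fps) : f 0%N \is a GRing.unit ->
  fps_mul f g =1 fps_of_poly 1 <-> g =1 fps_inv f.
Proof.
move=> Uf0; split=> [fg1 n | gE n]; last first.
  rewrite /fps_mul /fps_of_poly coef1 big_ord_recr /= subnn gE fps_invE.
  rewrite mulVKr //; under eq_bigr => i _ do rewrite gE.
  by rewrite addrC subrK.
elim/ltn_ind: n => n IHn; rewrite fps_invE.
have := fg1 n; rewrite /fps_mul /fps_of_poly coef1 big_ord_recr /= subnn.
under eq_bigr => i _ do rewrite IHn //.
by move=> <-; rewrite addrAC subrr add0r mulKr.
Qed.

End FormalPowerSeries.

(* The convention a_{-1} = 0 is the case n = 0. *)
Definition Lop (R : pzRingType) (a : nat -> R) : nat -> R :=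
  fun n => a n ^+ 2 - (if n is m.+1 then a m else 0) * a n.+1.

Definition fixed_by_L (R : pzRingType) (a : nat -> R) : Prop := Lop a =1 a.

(* Main.v *)
(** Comparing coefficients, [a] satisfies a third order linear recurrence which
    integrates to [a (n+2) = (k-1) a (n+1) - a n + 1]. Along this recurrence the
    quantity [x^2 + y^2 - (k-1) x y - x - y], with [x = a n] and [y = a (n+1)],
    is constant; it vanishes at [n = 0], and its vanishing is precisely the fixed
    point equation at [n+1]. *)

Require Import Defs.
From HB Require Import structures.
From mathcomp Require Import all_boot all_order all_algebra.
From mathcomp Require Import reals complex ring.

Set Implicit Arguments.
Unset Strict Implicit.
Unset Printing Implicit Defensive.

Import Order.TTheory GRing.Theory Num.Theory.
Local Open Scope ring_scope.

(** In [f * g = 1] with [f] of degree at most 3, each coefficient ties [g n] to at most three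
    earlier terms. *)
Lemma fps_inv_rec3 (R : comUnitRingType) (f : fps R) (g := fps_inv f) :
  f 0 = 1 -> (forall i, (3 < i)%N -> f i = 0) ->
  [/\ g 0 = 1, g 1 = - (f 1 * g 0), g 2 = - (f 2 * g 0 + f 1 * g 1) &
      forall n, g n.+3 = - (f 3 * g n + f 2 * g n.+1 + f 1 * g n.+2)].
Proof.
move=> f0 f_gt3.
have gE n : g n = (n == 0)%:R - \sum_(i < n) f (n - i)%N * g i.
  by rewrite /g fps_invE f0 invr1 mul1r.
split=> [|||n]; rewrite gE !(big_ord_recr, big_ord0) /= ?sub0r ?subr0 ?add0r //.
rewrite big1 ?add0r => [|i _]; last first.
  by rewrite f_gt3 ?mul0r // ltn_subRL addn3 !ltnS ltn_ord.
by rewrite -(addn3 n) addKn addn3 subSS -(addn2 n) addKn addn2 !subSS subSnn.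
Qed.

Lemma fixed_by_L_rec (R : comPzRingType) (k : R) (a : nat -> R) :
  a 0 = 1 -> a 1 = k -> a 2 = k * a 1 - k * a 0 ->
  (forall n, a n.+3 = k * a n.+2 - k * a n.+1 + a n) ->
  fixed_by_L a.
Proof.
move=> a0 a1 a2 a3.
(* [a n.+2 - (k - 1) * a n.+1 + a n] is constant in [n]: this reflects the factor [1 - x] of the
   denominator. *)
have rec2 n : a n.+2 = (k - 1) * a n.+1 - a n + 1.
  elim: n => [|n IHn]; first by rewrite a2 a1 a0; ring.
  by rewrite a3 IHn; ring: IHn.
have inv n : a n ^+ 2 + a n.+1 ^+ 2 - (k - 1) * a n * a n.+1
    - a n - a n.+1 = 0.
  elim: n => [|n IHn]; first by rewrite a1 a0; ring.
  (* With [y = a n.+1] fixed, the quantity is a quadratic in [x], unchanged under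
     [x -> (k - 1) * y + 1 - x], which sends [a n] to [a n.+2]. *)
  by rewrite -[RHS]IHn rec2; ring.
case=> [|n]; rewrite /Lop /=; first by rewrite a0; ring.
by apply/eqP; rewrite -subr_eq0 -(inv n) rec2; apply/eqP; ring.
Qed.

Theorem theorem3p3 (R : realType) (k : R[i]) (a : nat -> R[i])
    (ha : a =1 fps_inv (fps_of_poly (1 - k%:P * 'X + k%:P * 'X^2 - 'X^3))) :
  [/\ a =1 fps_inv (fps_of_poly ((1 - 'X) * (1 - (k - 1)%:P * 'X + 'X^2))),
      fixed_by_L a,
      a 0%N = 1 &
      a 1%N = k].
Proof.
set p := 1 - _ + _ - _ in ha.
have pE i : fps_of_poly p i =
    (i == 0)%:R - k * (i == 1)%:R + k * (i == 2)%:R - (i == 3)%:R.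
  by rewrite /fps_of_poly !(coefD, coefN, coefCM) coef1 coefX !coefXn.
have p0 : fps_of_poly p 0 = 1 by rewrite pE /= !mulr0 !subr0 addr0.
have p_gt3 i : (3 < i)%N -> fps_of_poly p i = 0.
  by case: i => [|[|[|[|i]]]] // _; rewrite pE /= !mulr0 !subr0 addr0.
(* The coefficients [1, -k, k, -1] of [p] yield the recurrence of [fixed_by_L_rec]. *)
have [] := fps_inv_rec3 p0 p_gt3; rewrite -!ha !pE /=.
rewrite !(mulr0, mulr1, subr0, sub0r, add0r, addr0, oppr0).
move=> a0 a1 a2 a3; have a1k : a 1 = k by rewrite a1 a0 mulr1 opprK.
split; [| | exact: a0 | exact: a1k].
  (* The factored denominator expands to [p]. *)
  move=> n; rewrite ha; congr (fps_inv (fps_of_poly _) n).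
  by rewrite /p polyCB; ring.
apply: (fixed_by_L_rec a0 a1k) => [|n]; first by rewrite a2; ring.
by move: (a3 n); rewrite -!ha => ->; ring.
Qed.
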